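(* Let $\lambda$ be a partition whose Young diagram $[\lambda]$ has $c$ corners, and let $x_1,\dots,x_{\lambda'_1},y_1,\dots,y_{\lambda_1}$ be positive reals. Let $(U_1,\dots,U_c)$ be the ordered set partition of $\{1,\dots,\lambda'_1\}$ into maximal sets of rows of equal length, ordered so that elements of $U_k$ are smaller than those of $U_l$ for $k<l$, and $X_k=\sum_{i\in U_k}x_i$; let $(V_1,\dots,V_c)$ be the analogous ordered set partition of $\{1,\dots,\lambda_1\}$ into maximal sets of columns of equal length, and $Y_k=\sum_{j\in V_k}y_j$. Number the corners $1,\dots,c$ from the top-right one to the bottom-left one, so that corner $r$ lies in a row of $U_r$ and a column of $V_{c+1-r}$. For $(i,j)\in[\lambda]$ let $(r_1,s_1)$ be the corner with the smallest $r_1\ge i$ and $(r_2,s_2)$ the corner with the smallest $s_2\ge j$, and define the modified hook of $(i,j)$ as $\{(k,j): r_1<k\le\lambda'_j\}\cup\{(i,l): s_2<l\le\lambda_i\}$. The modified weighted hook walk chooses a starting square $(i,j)\in[\lambda]$ with probability proportional to $x_iy_j$ and, at each step, moves from $(i,j)$ to a square of its modified hook, choosing $(k,j)$ with probability proportional to $x_k$ and $(i,l)$ with probability proportional to $y_l$; it ends when it reaches a square whose modified hook is empty, and we say it ends in corner $r$ if this final square lies in a row of $U_r$ and a column of $V_{c+1-r}$. Then, with $s=c+1-r$, the probability that the walk ends in corner $r$ equals $$\frac{X_rY_s}{\sum_{(p,q)\in[\lambda]}x_py_q}\prod_{i=1}^{r-1}\left(1+\frac{X_i}{X_{i+1}+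\dots+X_r+Y_{s+1}+\dots+Y_{c+1-i}}\right)\prod_{j=1}^{s-1}\left(1+\frac{Y_j}{X_{r+1}+\dots+X_{c+1-j}+Y_{j+1}+\dots+Y_s}\right).$$
   Context: $[\lambda]=\{(i,j): i\ge1,\ 1\le j\le\lambda_i\}$, rows indexed downward and columns to the right; $\lambda'_j=|\{i:\lambda_i\ge j\}|$. A corner is a square $(i,j)\in[\lambda]$ with $(i+1,j),(i,j+1)\notin[\lambda]$. If $\lambda$ has $c$ corners then it has $c$ distinct part sizes and $\lambda'$ has $c$ distinct part sizes. *)

(* Defs.v *)
From HB Require Import structures.
From mathcomp Require Import all_boot all_order all_algebra.
From mathcomp Require Import all_classical all_reals all_analysis.
Set Implicit Arguments.
Unset Strict Implicit.
Unset Printing Implicit Defensive.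
Import Order.TTheory GRing.Theory Num.Theory.
Local Open Scope classical_set_scope.
Local Open Scope ring_scope.

(* A partition is a weakly decreasing sequence of positive parts.  Rows,
   columns, blocks and corners are numbered from 1; the square (i, j) in row i
   and column j is a pair of naturals. *)
Section Shape.
Local Open Scope nat_scope.

Definition is_partition (lam : seq nat) : bool :=
  sorted geq lam && all (leq 1) lam.

(* lambda_i, for i >= 1; it is 0 beyond the last part *)
Definition part (lam : seq nat) (i : nat) : nat := nth 0 lam i.-1.

(* lambda'_j = #{i | lambda_i >= j} *)
Definition conj_part (lam : seq nat) : seq nat :=
  [seq count (leq j) lam | j <- iota 1 (part lam 1)].

Definition diagram (lam : seq nat) : seq (nat * nat) :=
  [seq (i, j) | i <- iota 1 (size lam), j <- iota 1 (part lam i)].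

Definition is_corner (lam : seq nat) (p : nat * nat) : bool :=
  [&& p \in diagram lam, (p.1.+1, p.2) \notin diagram lam
    & (p.1, p.2.+1) \notin diagram lam].

Definition corners (lam : seq nat) : seq (nat * nat) :=
  [seq p <- diagram lam | is_corner lam p].

(* The ordered set partition (U_1, ..., U_c) of the rows into maximal sets of
   rows of equal length: undup lists the distinct parts in decreasing order,
   which is the order of increasing row indices. *)
Definition row_blocks (lam : seq nat) : seq (seq nat) :=
  [seq [seq i <- iota 1 (size lam) | part lam i == a] | a <- undup lam].

Definition row_block (lam : seq nat) (k : nat) : seq nat :=
  nth [::] (row_blocks lam) k.-1.

Definition col_block (lam : seq nat) (k : nat) : seq nat :=
  row_block (conj_part lam) k.

(* r_1: the smallest row >= i containing a corner.  The default value of the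
   minimum is harmless, the last row always containing a corner. *)
Definition corner_row (lam : seq nat) (i : nat) : nat :=
  \big[minn/part (conj_part lam) 1]_(p <- corners lam | i <= p.1) p.1.

(* s_2: the smallest column >= j containing a corner *)
Definition corner_col (lam : seq nat) (j : nat) : nat :=
  \big[minn/part lam 1]_(p <- corners lam | j <= p.2) p.2.

Definition modified_hook (lam : seq nat) (p : nat * nat) : seq (nat * nat) :=
  [seq (k, p.2) | k <- index_iota (corner_row lam p.1).+1
                                  (part (conj_part lam) p.2).+1] ++
  [seq (p.1, l) | l <- index_iota (corner_col lam p.2).+1
                                  (part lam p.1).+1].

(* p lies in a row of U_r and a column of V_(c+1-r), where c is the number of
   corners *)
Definition at_corner (lam : seq nat) (r : nat) (p : nat * nat) : bool :=
  (p.1 \in row_block lam r) &&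
  (p.2 \in col_block lam ((size (corners lam)).+1 - r)).

End Shape.

Section Weights.
Context {R : realType}.
Variables (lam : seq nat) (x y : nat -> R).

Definition row_weight (k : nat) : R := \sum_(i <- row_block lam k) x i.

Definition col_weight (k : nat) : R := \sum_(j <- col_block lam k) y j.

Definition diagram_weight : R := \sum_(p <- diagram lam) x p.1 * y p.2.

Definition start_prob (p : nat * nat) : R :=
  if p \in diagram lam then x p.1 * y p.2 / diagram_weight else 0.

(* Weight of the move from p to a square q of its modified hook: x_k for a
   move to row k within the column of p, y_l for a move to column l within the
   row of p. *)
Definition move_weight (p q : nat * nat) : R :=
  if q.2 == p.2 then x q.1 else y q.2.

(* The end of the walk is modelled by absorption: a square with an empty
   modified hook is never left. *)
Definition move_prob (p q : nat * nat) : R :=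
  if modified_hook lam p is [::] then (q == p)%:R
  else if q \in modified_hook lam p
       then move_weight p q / \sum_(q' <- modified_hook lam p) move_weight p q'
       else 0.

End Weights.

Section Walk.
Context {R : realType} {d : measure_display} {T : measurableType d}.
Variable P : probability T R.

(* W n is the square occupied after n moves.  The second condition says that,
   conditionally on W 0 = h 0, ..., W n = h n, the next square is q with
   probability move_prob (h n) q. *)
Definition is_modified_hook_walk (lam : seq nat) (x y : nat -> R)
    (W : nat -> {RV P >-> (nat * nat)%type}) : Prop :=
  (forall p, P [set t | W 0%N t = p] = (start_prob lam x y p)%:E) /\
  (forall n (h : nat -> nat * nat),
     P [set t | forall k, (k <= n.+1)%N -> W k t = h k] =
     (P [set t | forall k, (k <= n)%N -> W k t = h k] *
      (move_prob lam x y (h n) (h n.+1))%:E)%E).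

Definition ends_in_corner (lam : seq nat) (W : nat -> {RV P >-> (nat * nat)%type})
    (r : nat) : set T :=
  [set t | exists n, modified_hook lam (W n t) = [::] /\
                     at_corner lam r (W n t)].

End Walk.

(* Main.v *)
Require Import Defs.
From HB Require Import structures.
From mathcomp Require Import all_boot all_order all_algebra.
From mathcomp Require Import all_classical all_reals all_analysis.
From mathcomp Require Import ring zify.
Set Implicit Arguments.
Unset Strict Implicit.
Unset Printing Implicit Defensive.
Import Order.TTheory GRing.Theory Num.Theory.
Local Open Scope ring_scope.

(**
The modified hook only sees the blocks of rows and columns: in terms of blocks
the diagram is the staircase a + b <= c + 1, a square of blocks (a, b) moves to
a row block k in (a, c + 1 - b] with weight X_k or to a column block l in
(b, c + 1 - a] with weight Y_l, and it is absorbed when a + b = c + 1.  For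
a <= r and b <= s the total hook weight splits as A_a + B_b, where A_a is the
hook weight of (a, s) and B_b that of (r, b).  Hence the probability of reaching
corner r from (a, b) factors as F_a G_b, where F_r = 1 and
A_a F_a = sum_{a < k <= r} X_k F_k, and similarly for G.  The partial sums
T_a = sum_{a <= k <= r} X_k F_k satisfy T_a = (1 + X_a / A_a) T_{a+1}, so that
averaging F_a G_b over the starting square gives the product formula.
*)

(** * Partitions, conjugates and corners *)

Section Partitions.
Local Open Scope nat_scope.
Implicit Types (lam : seq nat) (i j k a b : nat).

Lemma geq_trans : transitive geq.
Proof. by move=> u v w /= vu uw; apply: leq_trans uw vu. Qed.

(** In a weakly decreasing list the entries that are at least [j] form a prefix, and the count is
    its length. Positivity of [j] matters beyond the end of the list, where [nth] returns 0. *)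
Lemma count_geq_gt lam j k : sorted geq lam -> 0 < j ->
  (k < count (leq j) lam) = (j <= nth 0 lam k).
Proof.
move=> + j0; elim: lam k => [|u lam IH] k /=; first by rewrite nth_nil; lia.
rewrite path_sortedE; last exact: geq_trans.
move=> /andP[/allP ulam slam]; case: (leqP j u) => [ju|uj].
  by case: k => [|k] /=; [rewrite ju | rewrite add1n ltnS IH].
have lt_j v : v \in lam -> v < j by move=> /ulam /= vu; apply: leq_ltn_trans uj.
rewrite add0n (_ : count _ lam = 0); last first.
  by apply/eqP; rewrite -leqn0 leqNgt -has_count; apply/hasP => -[v /lt_j]; lia.
rewrite ltn0; apply/esym/negbTE; rewrite -ltnNge.
case: k => [//|k] /=; case: (ltnP k (size lam)) => [kl|lk].
  by apply: lt_j; apply: mem_nth.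
by rewrite nth_default.
Qed.

Section OnePartition.
Variable lam : seq nat.
Hypothesis lamP : is_partition lam.

Let lam_sorted : sorted geq lam. Proof. by case/andP: lamP. Qed.

Let lam_pos v : v \in lam -> 0 < v.
Proof. by case/andP: lamP => _ /allP; apply. Qed.

Lemma row_nonempty i : 0 < i -> (0 < part lam i) = (i <= size lam).
Proof.
case: i => // i _; rewrite /part /=.
by case: (ltnP i (size lam)) => il;
  [rewrite lam_pos ?mem_nth | rewrite nth_default].
Qed.

Lemma part_mem i : 0 < i <= size lam -> part lam i \in lam.
Proof. by case: i => // i /= il; rewrite mem_nth. Qed.

Lemma mem_part v : v \in lam -> exists2 i, 0 < i <= size lam & part lam i = v.
Proof.
move=> vl; exists (index v lam).+1; last exact: nth_index.
by rewrite /= index_mem.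
Qed.

Lemma part_conj j : 0 < j -> part (conj_part lam) j = count (leq j) lam.
Proof.
case: j => // j _; rewrite /part /conj_part /=.
case: (ltnP j (part lam 1)) => jl.
  by rewrite (nth_map 0) ?size_iota // nth_iota.
rewrite nth_default ?size_map ?size_iota //; apply/esym/eqP.
by rewrite -leqn0 leqNgt count_geq_gt // -ltnNge.
Qed.

(** Both sides say that (i, j) is a square of the diagram. This Galois connection is the form in
    which conjugation is used below. *)
Lemma leq_conj i j : 0 < i -> 0 < j ->
  (i <= part (conj_part lam) j) = (j <= part lam i).
Proof. by case: i => // i _ j0; rewrite part_conj // count_geq_gt. Qed.

Lemma conj1 : part (conj_part lam) 1 = size lam.
Proof. by rewrite part_conj //; apply/eqP; rewrite -all_count; case/andP: lamP. Qed.

Lemma size_conj : size (conj_part lam) = part lam 1.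
Proof. by rewrite size_map size_iota. Qed.

Lemma conj_is_partition : is_partition (conj_part lam).
Proof.
apply/andP; split.
  apply: (homo_sorted (e := leq)); last exact: iota_sorted.
  by move=> u v uv; apply: sub_count => w /=; apply: leq_trans.
apply/allP => v /mapP[j]; rewrite mem_iota => jl ->.
by case/andP: jl => j0 jl; rewrite count_geq_gt //; rewrite add1n in jl.
Qed.

Lemma mem_diagram p :
  (p \in diagram lam) = [&& 0 < p.1, 0 < p.2 & p.2 <= part lam p.1].
Proof.
apply/allpairsPdep/and3P => [[i [j [il jl ->]]]|[p1 p2 pl]] /=.
  by rewrite !mem_iota in il jl; split; lia.
exists p.1, p.2; rewrite !mem_iota -surjective_pairing; split=> //; last by lia.
by rewrite p1 add1n ltnS -row_nonempty //; lia.
Qed.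

Lemma diagram_uniq : uniq (diagram lam).
Proof.
apply: allpairs_uniq_dep => [|i _|]; try exact: iota_uniq.
by move=> [i j] [i' j'] _ _ /= [-> ->].
Qed.

Lemma part_anti i k : 0 < i -> i <= k -> part lam k <= part lam i.
Proof.
move=> i0 ik; case: (posnP (part lam k)) => [-> //|pk].
by rewrite -leq_conj // (leq_trans ik) // leq_conj //; lia.
Qed.

Lemma conj_anti j k : 0 < j -> j <= k ->
  part (conj_part lam) k <= part (conj_part lam) j.
Proof.
move=> j0 jk; rewrite !part_conj //; last by lia.
by apply: sub_count => w /=; apply: leq_trans.
Qed.

(** The usual closure identity of a Galois connection: the last row that reaches column [part lam i]
    has the same length as row [i]. *)
Lemma part_conj_part i : 0 < i <= size lam ->
  part lam (part (conj_part lam) (part lam i)) = part lam i.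
Proof.
move=> /andP[i0 il]; have pi0 : 0 < part lam i by rewrite row_nonempty.
have iC : i <= part (conj_part lam) (part lam i) by rewrite leq_conj.
apply/eqP; rewrite eqn_leq part_anti //=.
by rewrite -leq_conj //; apply: leq_trans iC.
Qed.

Lemma conj_part_conj j : 0 < j <= part lam 1 ->
  part (conj_part lam) (part lam (part (conj_part lam) j)) =
  part (conj_part lam) j.
Proof.
move=> /andP[j0 jl]; have pj0 : 0 < part (conj_part lam) j by rewrite leq_conj.
have jC : j <= part lam (part (conj_part lam) j) by rewrite -leq_conj.
apply/eqP; rewrite eqn_leq conj_anti //=.
by rewrite leq_conj //; apply: leq_trans jC.
Qed.

Lemma mem_corners p : (p \in corners lam) =
  [&& 0 < p.1, 0 < p.2, p.2 == part lam p.1 & p.1 == part (conj_part lam) p.2].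
Proof.
case: p => i j; rewrite mem_filter /is_corner !mem_diagram /=.
case: (posnP i) => [-> //|i0]; case: (posnP j) => [->|j0].
  by rewrite !andbF.
have := leq_conj i0 j0; have := @leq_conj i.+1 j isT j0; lia.
Qed.

(** An attained lower bound is the minimum. The default [m] takes part in the minimum as well, hence
    the condition [v <= m]. *)
Lemma bigmin_eq (I : eqType) (s : seq I) (Q : pred I) (F : I -> nat) m v :
  (forall p, p \in s -> Q p -> v <= F p) ->
  (exists2 p, p \in s & Q p && (F p == v)) -> v <= m ->
  \big[minn/m]_(p <- s | Q p) F p = v.
Proof.
move=> v_min [p ps /andP[Qp /eqP Fp]] vm; apply/eqP; rewrite eqn_leq.
apply/andP; split.
  rewrite -Fp; elim: s ps {v_min} => // u s IH; rewrite inE big_cons.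
  case/orP => [/eqP <-|/IH le_s]; first by rewrite Qp geq_minl.
  by case: ifP => // _; rewrite geq_min le_s orbT.
rewrite big_seq_cond; elim/big_ind: _ => // [u w|q /andP[]]; last exact: v_min.
by rewrite leq_min => -> ->.
Qed.

(** Rows of the same length as row [i] continue down to the last of them, and only there does a
    corner occur; a corner at or below row [i] has a column no longer than that row. *)
Lemma corner_rowE i : 0 < i <= size lam ->
  corner_row lam i = part (conj_part lam) (part lam i).
Proof.
move=> il; have /andP[i0 ile] := il.
have pi0 : 0 < part lam i by rewrite row_nonempty.
apply: bigmin_eq => [[u v]||].
- rewrite mem_corners /= => /and4P[u0 v0 /eqP vE /eqP uE] iu; rewrite uE.
  by apply: conj_anti => //; rewrite vE; apply: part_anti.
- exists (part (conj_part lam) (part lam i), part lam i) => /=.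
    rewrite mem_corners /= part_conj_part // !eqxx pi0 leq_conj //.
    by rewrite part_anti.
  by rewrite eqxx leq_conj // leqnn.
- by apply: conj_anti.
Qed.

Lemma corner_colE j : 0 < j <= part lam 1 ->
  corner_col lam j = part lam (part (conj_part lam) j).
Proof.
move=> jl; have /andP[j0 jle] := jl.
have pj0 : 0 < part (conj_part lam) j by rewrite leq_conj.
apply: bigmin_eq => [[u v]||].
- rewrite mem_corners /= => /and4P[u0 v0 /eqP vE /eqP uE] jv; rewrite vE.
  by apply: part_anti => //; rewrite uE; apply: conj_anti.
- exists (part (conj_part lam) j, part lam (part (conj_part lam) j)) => /=.
    by rewrite mem_corners /= conj_part_conj // !eqxx pj0 -leq_conj // conj_anti.
  by rewrite eqxx -leq_conj // leqnn.
- by apply: part_anti.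
Qed.

(** * Blocks of rows of equal length *)

Lemma undup_part_sorted : sorted gtn (undup lam).
Proof.
rewrite gtn_sorted_uniq_geq undup_uniq /=.
by apply: (subseq_sorted geq_trans (undup_subseq lam)).
Qed.

Lemma undup_part_lt a b : a < b -> b < size (undup lam) ->
  nth 0 (undup lam) b < nth 0 (undup lam) a.
Proof.
move=> ab bl; have gt_trans : transitive gtn by move=> u v w /= ? ?; lia.
by apply: (sorted_ltn_nth gt_trans 0 undup_part_sorted) => //; apply: ltn_trans bl.
Qed.

Lemma undup_part_mem a : a < size (undup lam) -> nth 0 (undup lam) a \in lam.
Proof. by move=> al; rewrite -mem_undup mem_nth. Qed.

Lemma undup_part_gt0 a : a < size (undup lam) -> 0 < nth 0 (undup lam) a.
Proof. by move=> al; apply: lam_pos; apply: undup_part_mem. Qed.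

(** The column coordinate maps the corners bijectively onto the distinct parts: a part [v] carries
    the corner at the end of the last row of length [v]. *)
Lemma size_corners : size (corners lam) = size (undup lam).
Proof.
rewrite -(size_map snd); apply: perm_size; apply: uniq_perm; rewrite ?undup_uniq //.
  rewrite map_inj_in_uniq ?filter_uniq ?diagram_uniq // => -[u v] [u' v'].
  rewrite !mem_corners /= => /and4P[_ _ _ /eqP ->] /and4P[_ _ _ /eqP ->].
  by move=> ->.
move=> v; rewrite mem_undup; apply/mapP/idP => [[p]|vl].
  rewrite mem_corners => /and4P[p1 p2 /eqP p2E _] ->; rewrite p2E part_mem //.
  by rewrite p1 -row_nonempty // -p2E.
exists (part (conj_part lam) v, v) => //; rewrite mem_corners /=.
have [i il <-] := mem_part vl.
rewrite part_conj_part // !eqxx leq_conj ?row_nonempty ?part_anti //; lia.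
Qed.

(* The last row of block a, and the block containing row i; for the conjugate
   partition, the last column of column block a and the block of column i. *)
Definition block_end a :=
  if a is k.+1 then part (conj_part lam) (nth 0 (undup lam) k) else 0.

Definition block_of i := (index (part lam i) (undup lam)).+1.

Lemma leq_block_end i k : 0 < i -> k < size (undup lam) ->
  (i <= block_end k.+1) = (nth 0 (undup lam) k <= part lam i).
Proof. by move=> i0 kl; rewrite leq_conj // undup_part_gt0. Qed.

(** Rows at least as long as the [k]-th distinct part end at [block_end k.+1], strictly longer ones
    at [block_end k]; the rows between form one block. Blocks are counted from 1 and entries of
    [undup lam] from 0. *)
Lemma block_endP i k : 0 < i -> k < size (undup lam) ->
  (block_end k < i <= block_end k.+1) = (part lam i == nth 0 (undup lam) k).
Proof.
move=> i0 kl; rewrite leq_block_end //; apply/andP/eqP => [[ki ik]|iE].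
  have /part_mem : 0 < i <= size lam.
    by rewrite i0 -row_nonempty // (leq_trans _ ik) // undup_part_gt0.
  rewrite -mem_undup => /(nthP 0)[l ll lE]; rewrite -lE; rewrite -lE in ik.
  congr nth; case: (ltngtP l k) => // [lk|kl'].
    case: k ki ik kl lk => // k + _ kl lk.
    rewrite ltnNge leq_block_end ?(ltnW kl) // -lE => /negP[].
    have [->//|lk'] := eqVneq l k; apply: ltnW; apply: undup_part_lt; lia.
  by move: ik; rewrite leqNgt undup_part_lt.
split; last by rewrite iE.
case: k kl iE => // k kl iE; rewrite ltnNge leq_block_end ?(ltnW kl) //.
by rewrite -ltnNge iE undup_part_lt.
Qed.

Lemma part_nth_conj k : k < size (undup lam) ->
  part lam (part (conj_part lam) (nth 0 (undup lam) k)) = nth 0 (undup lam) k.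
Proof.
by move=> /undup_part_mem /mem_part[i il <-]; apply: part_conj_part.
Qed.

Lemma block_end_lt a b : a < b -> b <= size (undup lam) ->
  block_end a < block_end b.
Proof.
case: b => // b; rewrite ltnS => ab bl.
have b0 : 0 < block_end b.+1.
  rewrite leq_block_end //; have [i /andP[i0 il] <-] := mem_part (undup_part_mem bl).
  exact: part_anti.
case: a ab => // a ab; rewrite ltnNge leq_block_end //; last exact: ltn_trans bl.
by rewrite /block_end part_nth_conj // -ltnNge undup_part_lt.
Qed.

Lemma block_end_le a b : a <= b -> b <= size (undup lam) ->
  block_end a <= block_end b.
Proof.
rewrite leq_eqVlt => /predU1P[-> //|ab bl]; apply: ltnW; exact: block_end_lt.
Qed.

Lemma block_of_le i : 0 < i <= size lam -> block_of i <= size (undup lam).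
Proof. by move=> il; rewrite /block_of index_mem mem_undup part_mem. Qed.

Lemma block_of_bounds i : 0 < i <= size lam ->
  block_end (block_of i).-1 < i <= block_end (block_of i).
Proof.
move=> il; rewrite block_endP ?nth_index ?mem_undup ?part_mem ?block_of_le //.
by case/andP: il.
Qed.

Lemma block_of_eq i k : 0 < i -> k < size (undup lam) ->
  block_end k < i <= block_end k.+1 -> block_of i = k.+1.
Proof.
by move=> i0 kl; rewrite block_endP // /block_of => /eqP ->;
  rewrite index_uniq ?undup_uniq.
Qed.

Lemma block_end_block_of i : 0 < i <= size lam ->
  block_end (block_of i) = part (conj_part lam) (part lam i).
Proof. by move=> il; rewrite /= nth_index // mem_undup part_mem. Qed.

Lemma block_end_size : block_end (size (undup lam)) = size lam.
Proof.
case: (posnP (size lam)) => [/size0nil -> //|l0].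
have il : 0 < size lam <= size lam by rewrite l0 leqnn.
apply/eqP; rewrite eqn_leq; apply/andP; split; last first.
  have /andP[_ le_e] := block_of_bounds il; apply: leq_trans le_e _.
  by apply: block_end_le => //; apply: block_of_le.
case E : (size (undup lam)) => [//|k]; rewrite /= -conj1.
by apply: conj_anti => //; apply: undup_part_gt0; rewrite E.
Qed.

(** Two strictly increasing lists with the same members agree. As intervals, consecutive blocks
    concatenate, which lets sums over rows be regrouped by blocks. *)
Lemma row_block_iota k : k < size (undup lam) ->
  row_block lam k.+1 = index_iota (block_end k).+1 (block_end k.+1).+1.
Proof.
move=> kl; rewrite /row_block /row_blocks (nth_map 0) //=.
apply: (irr_sorted_eq ltn_trans ltnn).
- by apply: sorted_filter; [exact: ltn_trans | exact: iota_ltn_sorted].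
- exact: iota_ltn_sorted.
move=> i; rewrite mem_filter mem_index_iota mem_iota add1n !ltnS.
case: (posnP i) => [->|i0]; first by rewrite andbF.
rewrite -(block_endP i0 kl) andTb andbC; apply/andP/idP => [[]//|ie]; split=> //.
have /andP[_ ik] := ie; apply: leq_trans ik _.
by rewrite -block_end_size; exact: (block_end_le kl).
Qed.

Lemma mem_row_block r i : 0 < r <= size (undup lam) -> 0 < i <= size lam ->
  (i \in row_block lam r) = (block_of i == r).
Proof.
case: r => // r /= rl il; have /andP[i0 _] := il.
rewrite row_block_iota // mem_index_iota ltnS; apply/idP/eqP => [|rE].
  exact: block_of_eq.
by have := block_of_bounds il; rewrite rE.
Qed.

End OnePartition.

(** * Conjugation and the reversal of blocks *)

Lemma leq_ext m n : (forall j, 0 < j -> (j <= m) = (j <= n)) -> m = n.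
Proof. by move=> mn; have := mn m; have := mn n; lia. Qed.

Lemma conj_partK lam : is_partition lam -> conj_part (conj_part lam) = lam.
Proof.
move=> lamP; have conjP := conj_is_partition lamP.
have sz : size (conj_part (conj_part lam)) = size lam.
  by rewrite size_conj conj1.
apply: (eq_from_nth (x0 := 0)) => // k _; apply: leq_ext => j j0.
rewrite -[nth _ lam k]/(part lam k.+1) -(leq_conj lamP) //.
by rewrite -[nth _ _ k]/(part (conj_part (conj_part lam)) k.+1) leq_conj.
Qed.

(** A column always stops at the end of a row block, and the longest columns stop at the last one.
    This reversal is the source of the pairing of [r] with [c + 1 - r]. *)
Lemma undup_conj lam : is_partition lam -> undup (conj_part lam) =
  [seq block_end lam (size (undup lam) - b) | b <- iota 0 (size (undup lam))].
Proof.
move=> lamP.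
have gt_trans : transitive gtn by move=> u v w /= ? ?; lia.
apply: (irr_sorted_eq gt_trans ltnn).
- exact: undup_part_sorted (conj_is_partition lamP).
- apply: (homo_sorted_in (P := [pred b | b < size (undup lam)])
    (e := ltn)); last exact: iota_ltn_sorted.
    move=> u v; rewrite !inE => ul vl uv; apply: block_end_lt => //.
      exact: ltn_sub2l.
    exact: leq_subr.
  by apply/allP => u; rewrite mem_iota.
move=> v; rewrite mem_undup; apply/mapP/mapP => [[j]|[b]].
  rewrite mem_iota add1n ltnS => jl ->.
  have /andP[j0 jle] := jl; rewrite -part_conj //.
  have il : 0 < part (conj_part lam) j <= size lam.
    by rewrite leq_conj // jle -conj1 // conj_anti.
  exists (size (undup lam) - block_of lam (part (conj_part lam) j)).
    by rewrite mem_iota add0n ltn_subrL /= (leq_trans _ (block_of_le il)).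
  by rewrite subKn ?block_of_le // block_end_block_of // conj_part_conj.
rewrite mem_iota add0n => /= bl ->.
have -> : size (undup lam) - b = (size (undup lam) - b).-1.+1.
  by rewrite prednK ?subn_gt0.
have kl : (size (undup lam) - b).-1 < size (undup lam).
  by rewrite prednK ?subn_gt0 // leq_subr.
have [i /andP[i0 il] iE] := mem_part (undup_part_mem kl).
(* The witness is the last column met by the rows of block [size (undup lam) - b]; its length is the
   end of that block. *)
exists (nth 0 (undup lam) (size (undup lam) - b).-1).
  by rewrite mem_iota add1n ltnS undup_part_gt0 // -iE part_anti.
by rewrite /= part_conj // undup_part_gt0.
Qed.

Lemma size_undup_conj lam : is_partition lam ->
  size (undup (conj_part lam)) = size (undup lam).
Proof. by move=> lamP; rewrite undup_conj // size_map size_iota. Qed.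

Lemma nth_undup_conj lam k : is_partition lam -> k < size (undup lam) ->
  nth 0 (undup (conj_part lam)) k = block_end lam (size (undup lam) - k).
Proof.
by move=> lamP kl; rewrite undup_conj // (nth_map 0) ?size_iota // nth_iota.
Qed.

Lemma block_end_conj lam b : is_partition lam -> b <= size (undup lam) ->
  block_end (conj_part lam) b = nth 0 (undup lam) (size (undup lam) - b).
Proof.
move=> lamP; case: b => [_|k kl]; first by rewrite subn0 nth_default.
rewrite /= nth_undup_conj // conj_partK //.
have kl' : size (undup lam) - k.+1 < size (undup lam).
  by rewrite ltn_subrL (leq_ltn_trans _ kl).
by rewrite -(subnSK kl) /= part_nth_conj.
Qed.

(** The staircase shape: a row of block [a] ends exactly where column block [c + 1 - a] does, [c]
    being the number of distinct parts. *)
Lemma part_block lam i : is_partition lam -> 0 < i <= size lam ->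
  part lam i = block_end (conj_part lam) ((size (undup lam)).+1 - block_of lam i).
Proof.
move=> lamP il; have := block_of_le il; rewrite /block_of => kl.
by rewrite subSS block_end_conj ?leq_subr // subKn 1?ltnW // nth_index //
  mem_undup part_mem.
Qed.

Lemma conj_part_block lam j : is_partition lam -> 0 < j <= part lam 1 ->
  part (conj_part lam) j =
  block_end lam ((size (undup lam)).+1 - block_of (conj_part lam) j).
Proof.
move=> lamP jl; rewrite part_block ?size_conj //; last exact: conj_is_partition.
by rewrite conj_partK // size_undup_conj.
Qed.

End Partitions.

(** * The one-dimensional recursion and its product solution *)

Section HookFactor.
Variable R : fieldType.
Variables (r : nat) (X A : nat -> R).

(** The explicit solution of the recursion for F. It is 0 beyond [r] because row blocks never
    decrease along the walk, so corner [r] is out of reach from there. *)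
Definition hook_factor (a : nat) : R :=
  if a == r then 1
  else if (a < r)%N then X r * \prod_(a.+1 <= i < r) (1 + X i / A i) / A a
  else 0.

Lemma hook_factor_id : hook_factor r = 1.
Proof. by rewrite /hook_factor eqxx. Qed.

Lemma hook_factor_gt a : (r < a)%N -> hook_factor a = 0.
Proof. by move=> ra; rewrite /hook_factor gtn_eqF // ltnNge (ltnW ra). Qed.

(** Peeling off the first term [X a.+1 * hook_factor a.+1] multiplies the remaining sum by
    [1 + X a.+1 / A a.+1], since [hook_factor a.+1] is that remaining sum divided by [A a.+1]. *)
Lemma sum_hook_factor a : (a < r)%N -> 
  \sum_(a.+1 <= k < r.+1) X k * hook_factor k =
  X r * \prod_(a.+1 <= i < r) (1 + X i / A i).
Proof.
move=> ar; have rE : r = (a + (r - a.+1)).+1 by rewrite -addSn subnKC.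
move: (r - a.+1)%N rE => n; elim: n a {ar} => [|n IH] a rE.
  rewrite addn0 in rE; rewrite rE big_nat1 big_geq // -rE.
  by rewrite hook_factor_id.
have ar : (a.+1 < r)%N by rewrite rE addnS !ltnS leq_addr.
rewrite [in LHS]big_ltn; last exact: leqW.
rewrite (IH a.+1) ?addSnnS // [in RHS]big_ltn //.
rewrite /hook_factor ltn_eqF // ar.
by ring.
Qed.

Lemma hook_factorM a : (a <= r)%N -> A r = 0 ->
  (forall k, (a <= k < r)%N -> A k != 0) ->
  hook_factor a * A a = \sum_(a.+1 <= k < r.+1) X k * hook_factor k.
Proof.
move=> ar Ar A0; have [->|ar'] := eqVneq a r.
  by rewrite Ar mulr0 big_geq.
have {}ar' : (a < r)%N by rewrite ltn_neqAle ar' ar.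
rewrite sum_hook_factor // /hook_factor ltn_eqF // ar' divfK // A0 //.
by rewrite leqnn.
Qed.

End HookFactor.

Arguments block_end : simpl never.

Lemma arm_range m a b : (0 < b)%N -> (a + b <= m.+1)%N -> (a <= m.+1 - b <= m)%N.
Proof. by move=> ? ?; apply/andP; split; lia. Qed.

Lemma strict_arm_range m a b : (0 < b)%N -> (a + b < m.+1)%N ->
  (a < m.+1 - b <= m)%N.
Proof. by move=> ? ?; apply/andP; split; lia. Qed.

(** * Harmonicity on the staircase of blocks *)

Section BlockWalk.
Variables (R : realFieldType) (c : nat).
Implicit Types (X Y : nat -> R) (r a b m : nat).

(* The hook weight of the block square (a, c + 1 - r), in the column of corner
   r; by symmetry arm Y X (c + 1 - r) b is that of (r, b), in its row. *)
Definition arm X Y r a : R :=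
  \sum_(a.+1 <= k < r.+1) X k + \sum_((c.+1 - r).+1 <= k < (c.+1 - a).+1) Y k.

Lemma sum_ge0_block X a m : (forall k, (0 < k <= c)%N -> 0 < X k) ->
  (m <= c)%N -> 0 <= \sum_(a.+1 <= k < m.+1) X k.
Proof.
move=> X0 mc; rewrite big_nat; apply: sumr_ge0 => k /andP[ak km].
by apply/ltW/X0; rewrite (leq_ltn_trans _ ak) // (leq_trans _ mc).
Qed.

Lemma sum_gt0_block X a m : (forall k, (0 < k <= c)%N -> 0 < X k) ->
  (a < m <= c)%N -> 0 < \sum_(a.+1 <= k < m.+1) X k.
Proof.
move=> X0 /andP[am mc]; rewrite big_nat_recr //=.
apply: ltr_wpDl; last by apply: X0; rewrite mc (leq_ltn_trans _ am).
case: m am mc => // m _ mc; apply: sum_ge0_block => //; exact: ltnW.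
Qed.

Lemma arm_gt0 X Y r a : (forall k, (0 < k <= c)%N -> 0 < X k) ->
  (forall k, (0 < k <= c)%N -> 0 < Y k) -> (0 < a < r)%N -> (r <= c)%N ->
  0 < arm X Y r a.
Proof.
move=> X0 Y0 /andP[a0 ar] rc; apply: ltr_pwDl.
  by apply: sum_gt0_block; rewrite ?ar.
by apply: sum_ge0_block => //; lia.
Qed.

Lemma arm_id X Y r : arm X Y r r = 0.
Proof. by rewrite /arm !big_geq // addr0. Qed.

(** The factors vanish beyond [r], so any upper bound [m >= r] gives the sum up to [r], where the
    recursion applies; for [a > r] both sides are 0. *)
Lemma sum_hook_factor_arm X Y r a m :
  (forall k, (0 < k <= c)%N -> 0 < X k) ->
  (forall k, (0 < k <= c)%N -> 0 < Y k) -> (0 < a)%N -> (r <= c)%N ->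
  (r <= m)%N ->
  \sum_(a.+1 <= k < m.+1) X k * hook_factor r X (arm X Y r) k =
  hook_factor r X (arm X Y r) a * arm X Y r a.
Proof.
move=> X0 Y0 a0 rc rm; case: (leqP a r) => ar.
  rewrite (big_cat_nat (n := r.+1)) //= -hook_factorM ?arm_id //.
    rewrite [X in _ + X]big_nat big1 ?addr0 // => k /andP[rk _].
    by rewrite hook_factor_gt ?mulr0.
  move=> k /andP[ak kr]; apply: lt0r_neq0; apply: arm_gt0 => //.
  by rewrite kr (leq_trans a0).
rewrite hook_factor_gt // mul0r big_nat big1 // => k /andP[ak _].
by rewrite hook_factor_gt ?mulr0 // (ltn_trans ar).
Qed.

(** Cut the row range at [r] and the column range at [c + 1 - r]. The near row piece and the far
    column piece form the hook of (a, c + 1 - r); the other two form that of (r, b). *)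
Lemma arm_split X Y r a b : (0 < a <= r)%N -> (0 < b <= c.+1 - r)%N ->
  (r <= c)%N ->
  \sum_(a.+1 <= k < (c.+1 - b).+1) X k + \sum_(b.+1 <= k < (c.+1 - a).+1) Y k =
  arm X Y r a + arm Y X (c.+1 - r) b.
Proof.
move=> ar bs rc; rewrite /arm subKn; last exact: leqW.
rewrite (big_cat_nat (n := r.+1)) /=; [|lia|lia].
rewrite (big_cat_nat (n := (c.+1 - r).+1) (m := b.+1)) /=; [ring|lia|lia].
Qed.

Lemma hook_factor_harmonic X Y r a b :
  (forall k, (0 < k <= c)%N -> 0 < X k) ->
  (forall k, (0 < k <= c)%N -> 0 < Y k) ->
  (0 < r <= c)%N -> (0 < a)%N -> (0 < b)%N ->
  let F := hook_factor r X (arm X Y r) in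
  let G := hook_factor (c.+1 - r) Y (arm Y X (c.+1 - r)) in
  \sum_(a.+1 <= k < (c.+1 - b).+1) X k * (F k * G b) +
  \sum_(b.+1 <= k < (c.+1 - a).+1) Y k * (F a * G k) =
  F a * G b * (\sum_(a.+1 <= k < (c.+1 - b).+1) X k +
               \sum_(b.+1 <= k < (c.+1 - a).+1) Y k).
Proof.
move=> X0 Y0 /andP[r0 rc] a0 b0 F G.
under eq_bigr do rewrite mulrA.
under [X in _ + X]eq_bigr do rewrite mulrCA.
rewrite -mulr_suml -mulr_sumr.
have sc : (c.+1 - r <= c)%N by lia.
(* For [a > r] the factor [F] vanishes at [a] and at all later blocks, so both sides are 0; the same
   happens with [G] below. *)
case: (leqP a r) => ar; last first.
  rewrite [F a]hook_factor_gt // !mul0r addr0 big_nat.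
  rewrite big1 ?mul0r // => k /andP[ak _].
  by rewrite /F hook_factor_gt ?mulr0 // (ltn_trans ar).
case: (leqP b (c.+1 - r)) => bs; last first.
  rewrite [G b]hook_factor_gt // !mulr0 mul0r add0r big_nat.
  rewrite big1 ?mulr0 // => k /andP[bk _].
  by rewrite /G hook_factor_gt ?mulr0 // (ltn_trans bs).
rewrite (arm_split X Y (r := r)) ?a0 ?b0 // !sum_hook_factor_arm //; [|lia|lia].
by rewrite -/F -/G; ring.
Qed.

End BlockWalk.

(** * From squares to blocks *)

Section Squares.
Variables (R : realType) (lam : seq nat).
Hypothesis lamP : is_partition lam.
Local Notation c := (size (undup lam)).

(** A function of the block is constant on each block, so the row weights inside a block add up to
    the block weight. *)
Lemma sum_blocks (z phi : nat -> R) a b : (a <= b <= c)%N ->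
  \sum_((block_end lam a).+1 <= i < (block_end lam b).+1) z i * phi (block_of lam i)
  = \sum_(a.+1 <= k < b.+1) row_weight lam z k * phi k.
Proof.
elim: b => [|b IH] /andP[ab bc].
  by move: ab; rewrite leqn0 => /eqP ->; rewrite !big_geq.
move: ab; rewrite leq_eqVlt => /predU1P[->|ab]; first by rewrite !big_geq.
rewrite (big_cat_nat (n := (block_end lam b).+1)) /=;
  [|by rewrite ltnS; apply: block_end_le; rewrite ?(ltnW bc)
   |by rewrite ltnS; apply: block_end_le].
rewrite IH ?(ltnW bc) ?andbT // [RHS]big_nat_recr //=; congr (_ + _).
rewrite /row_weight row_block_iota // mulr_suml; apply: eq_big_nat => i ib.
rewrite (block_of_eq lamP (k := b)) //.
by apply: leq_ltn_trans (_ : (block_end lam b < i)%N); case/andP: ib.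
Qed.

Lemma row_weight_gt0 (z : nat -> R) k :
  (forall i, (1 <= i <= size lam)%N -> 0 < z i) -> (0 < k <= c)%N ->
  0 < row_weight lam z k.
Proof.
move=> z0; case: k => // k /= kc; rewrite /row_weight row_block_iota //.
have z0' i : (block_end lam k < i <= block_end lam k.+1)%N -> 0 < z i.
  move=> /andP[ki ik]; apply: z0; rewrite (leq_ltn_trans _ ki) //.
  by rewrite (leq_trans ik) // -(block_end_size lamP); exact: block_end_le.
have lt_e := block_end_lt lamP (ltnSn k) kc.
rewrite big_nat_recr //=; apply: ltr_wpDl; last by apply: z0'; rewrite lt_e leqnn.
rewrite big_nat; apply: sumr_ge0 => i /andP[ki ik]; apply/ltW/z0'.
by rewrite ki ltnW.
Qed.

Lemma mem_diagram_conj p : p \in diagram lam ->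
  (0 < p.1 <= size lam)%N /\ (0 < p.2 <= part lam 1)%N.
Proof.
rewrite mem_diagram // => /and3P[p1 p2 pl]; split.
  by rewrite p1 -row_nonempty // (leq_trans p2).
by rewrite p2 (leq_trans pl) // part_anti.
Qed.

(** The modified hook is made of whole blocks: it starts right after the block of [p] and ends at
    the end of a block, in both directions. *)
Lemma modified_hookE p : p \in diagram lam ->
  modified_hook lam p =
  [seq (k, p.2) | k <- index_iota (block_end lam (block_of lam p.1)).+1
     (block_end lam (c.+1 - block_of (conj_part lam) p.2)).+1] ++
  [seq (p.1, l) | l <- index_iota
     (block_end (conj_part lam) (block_of (conj_part lam) p.2)).+1
     (block_end (conj_part lam) (c.+1 - block_of lam p.1)).+1].
Proof.
move=> /mem_diagram_conj[p1 p2]; have conjP := conj_is_partition lamP.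
rewrite /modified_hook corner_rowE // corner_colE // -part_block //.
rewrite -conj_part_block // block_end_block_of // block_end_block_of ?size_conj //.
by rewrite conj_partK.
Qed.

Lemma block_sum_le p : p \in diagram lam ->
  (block_of lam p.1 + block_of (conj_part lam) p.2 <= c.+1)%N.
Proof.
move=> pD; have [p1 p2] := mem_diagram_conj pD.
have conjP := conj_is_partition lamP.
have bc : (block_of (conj_part lam) p.2 <= c)%N.
  by rewrite -size_undup_conj // block_of_le // size_conj.
have ac := block_of_le p1.
move: pD; rewrite mem_diagram // (part_block lamP p1) => /and3P[_ p20 ple].
rewrite addnC leqNgt; apply/negP => lt.
have /andP[lt_p _] := block_of_bounds conjP (i := p.2) ltac:(by rewrite size_conj).
suff : (block_end (conj_part lam) (c.+1 - block_of lam p.1) <=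
        block_end (conj_part lam) (block_of (conj_part lam) p.2).-1)%N.
  by move=> le; have := leq_trans ple le; rewrite leqNgt lt_p.
apply: block_end_le => //; first by move: lt; rewrite /block_of; lia.
by rewrite size_undup_conj //; exact: leq_trans (leq_pred _) bc.
Qed.


(** Each move goes down or to the right inside the diagram; the strict growth of [p.1 + p.2] later
    forces the walk to stop in bounded time. *)
Lemma mem_modified_hook p q : p \in diagram lam ->
  q \in modified_hook lam p ->
  q \in diagram lam /\ (p.1 + p.2 < q.1 + q.2)%N.
Proof.
move=> pD; have [p1 p2] := mem_diagram_conj pD.
have conjP := conj_is_partition lamP.
rewrite modified_hookE // -part_block // -conj_part_block // mem_cat.
have /andP[_ ple] := block_of_bounds lamP p1.
have /andP[_ ple'] := block_of_bounds conjP (i := p.2) ltac:(by rewrite size_conj).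
have [p10 p20] : (0 < p.1)%N /\ (0 < p.2)%N by case/andP: p1; case/andP: p2.
case/orP => /mapP[k]; rewrite mem_index_iota ltnS => /andP[lt_k k_le] ->.
  have pk : (p.1 < k)%N by apply: leq_ltn_trans lt_k.
  rewrite mem_diagram //= ltn_add2r p20 -(leq_conj lamP) ?k_le ?pk //; last lia.
  by rewrite (leq_ltn_trans _ pk).
have pk : (p.2 < k)%N by apply: leq_ltn_trans lt_k.
by rewrite mem_diagram //= ltn_add2l p10 k_le pk (leq_ltn_trans _ pk).
Qed.

(** With [a] and [b] the blocks of [p], the two arms run over the blocks in (a, c + 1 - b] and (b, c
    + 1 - a], which are empty exactly on the boundary of the staircase. *)
Lemma modified_hook_nil p : p \in diagram lam ->
  (modified_hook lam p == [::]) =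
  (block_of lam p.1 + block_of (conj_part lam) p.2 == c.+1)%N.
Proof.
move=> pD; have [p1 p2] := mem_diagram_conj pD; have := block_sum_le pD.
have conjP := conj_is_partition lamP.
rewrite modified_hookE //.
set a := block_of lam p.1; set b := block_of _ p.2 => abc.
have a0 : (0 < a)%N by [].
have b0 : (0 < b)%N by [].
clearbody a b; apply/eqP/eqP => [/(congr1 size)/=|abE].
  rewrite size_cat !size_map !size_iota !subSS => sz0.
  apply/eqP; rewrite eqn_leq abc leqNgt; apply/negP => lt.
  move/eqP: sz0; rewrite addn_eq0 subn_eq0 leqNgt => /andP[/negP + _]; apply.
  apply: block_end_lt => //; first by rewrite ltn_subRL addnC.
  by rewrite leq_subLR -add1n leq_add2r.
have -> : (c.+1 - b = a)%N by rewrite -abE addnK.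
have -> : (c.+1 - a = b)%N by rewrite -abE addKn.
by rewrite /index_iota !subnn.
Qed.

End Squares.

(** * The hitting probability of a corner as a harmonic function *)

Section Weighted.
Variables (R : realType) (lam : seq nat).
Hypothesis lamP : is_partition lam.
Local Notation c := (size (undup lam)).
Variables (x y : nat -> R) (r : nat).
Hypothesis x_gt0 : forall i, (1 <= i <= size lam)%N -> 0 < x i.
Hypothesis y_gt0 : forall j, (1 <= j <= part lam 1)%N -> 0 < y j.
Hypothesis r_bounds : (0 < r <= c)%N.

Let X := row_weight lam x.
Let Y := col_weight lam y.
Let s := (c.+1 - r)%N.
Let F := hook_factor r X (arm c X Y r).
Let G := hook_factor s Y (arm c Y X s).

Let conjP : is_partition (conj_part lam). Proof. exact: conj_is_partition. Qed.

Let X_gt0 k : (0 < k <= c)%N -> 0 < X k.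
Proof. exact: (row_weight_gt0 lamP). Qed.

Let Y_gt0 k : (0 < k <= c)%N -> 0 < Y k.
Proof.
move=> kc; rewrite -[Y k]/(row_weight (conj_part lam) y k).
apply: (row_weight_gt0 conjP).
  by move=> j; rewrite size_conj; exact: y_gt0.
by rewrite size_undup_conj.
Qed.

(* The probability that the walk from p ends in corner r. *)
Definition corner_hitting p : R :=
  F (block_of lam p.1) * G (block_of (conj_part lam) p.2).

Lemma sum_rows (phi : nat -> R) a b : (a <= b <= c)%N ->
  \sum_((block_end lam a).+1 <= i < (block_end lam b).+1)
    x i * phi (block_of lam i) = \sum_(a.+1 <= k < b.+1) X k * phi k.
Proof. exact: (sum_blocks lamP). Qed.

Lemma sum_cols (phi : nat -> R) a b : (a <= b <= c)%N ->
  \sum_((block_end (conj_part lam) a).+1 <= j < (block_end (conj_part lam) b).+1)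
    y j * phi (block_of (conj_part lam) j) =
  \sum_(a.+1 <= k < b.+1) Y k * phi k.
Proof. by move=> ab; apply: (sum_blocks conjP); rewrite size_undup_conj. Qed.

(** Stated for an arbitrary product so as to serve twice: constant functions 1 give the total hook
    weight, and [F], [G] give the weighted sum of hitting probabilities. *)
Lemma sum_modified_hook (f g : nat -> R) p : p \in diagram lam ->
  let a := block_of lam p.1 in let b := block_of (conj_part lam) p.2 in
  \sum_(q <- modified_hook lam p) move_weight x y p q *
    (f (block_of lam q.1) * g (block_of (conj_part lam) q.2)) =
  \sum_(a.+1 <= k < (c.+1 - b).+1) X k * (f k * g b) +
  \sum_(b.+1 <= k < (c.+1 - a).+1) Y k * (f a * g k).
Proof.
move=> pD a b; have abc : (a + b <= c.+1)%N := block_sum_le lamP pD.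
have [p1 p2] := mem_diagram_conj lamP pD.
have a0 : (0 < a)%N by []. have b0 : (0 < b)%N by [].
have /andP[_ ple] := block_of_bounds conjP (i := p.2) ltac:(by rewrite size_conj).
rewrite (modified_hookE lamP) // big_cat !big_map /=; congr (_ + _).
  rewrite -(sum_rows (fun k => f k * g b)) -/a -/b; last exact: arm_range.
  by apply: eq_bigr => k _; rewrite /move_weight eqxx.
rewrite -(sum_cols (fun k => f a * g k)) -/a -/b;
  last by apply: arm_range; rewrite // addnC.
(* [move_weight] tells the two kinds of moves apart by comparing columns; squares of the horizontal
   arm lie strictly to the right of [p], so they get the weight [y]. *)
apply: eq_big_nat => k /andP[bk _]; rewrite /move_weight gtn_eqF //=.
exact: leq_ltn_trans bk.
Qed.

Lemma modified_hook_uniq p : p \in diagram lam -> uniq (modified_hook lam p).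
Proof.
move=> pD; have [p1 p2] := mem_diagram_conj lamP pD.
have /andP[_ ple] := block_of_bounds conjP (i := p.2) ltac:(by rewrite size_conj).
rewrite (modified_hookE lamP) // cat_uniq !map_inj_uniq ?iota_uniq //=; last 2 first.
- by move=> u v [].
- by move=> u v [].
rewrite andbT; apply/hasPn => _ /mapP[l + ->]; rewrite mem_index_iota.
move=> /andP[bl _]; apply/mapP => -[k _ [_ lE]].
by have := leq_ltn_trans ple bl; rewrite lE ltnn.
Qed.

Lemma move_prob_out p q : p \in diagram lam -> q \notin diagram lam ->
  move_prob lam x y p q = 0.
Proof.
move=> pD qD; rewrite /move_prob; case E: (modified_hook lam p) => [|u h].
  by case: eqVneq qD => // ->; rewrite pD.
rewrite -E; case: ifP => // /(mem_modified_hook lamP pD)[qD' _].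
by rewrite qD' in qD.
Qed.

Lemma move_prob_back p q : p \in diagram lam -> modified_hook lam p != [::] ->
  (q.1 + q.2 <= p.1 + p.2)%N -> move_prob lam x y p q = 0.
Proof.
move=> pD p_go le; rewrite /move_prob.
case E: (modified_hook lam p) p_go => [//|u h] _.
by rewrite -E; case: ifP => // /(mem_modified_hook lamP pD)[_]; rewrite ltnNge le.
Qed.

Lemma move_prob_stop p q : modified_hook lam p == [::] ->
  move_prob lam x y p q = (q == p)%:R.
Proof. by move=> /eqP E; rewrite /move_prob E. Qed.

Lemma corner_hitting_harmonic p : p \in diagram lam ->
  corner_hitting p =
  \sum_(q <- diagram lam) move_prob lam x y p q * corner_hitting q.
Proof.
move=> pD; have [p1 p2] := mem_diagram_conj lamP pD.
have [p_stop|p_go] := eqVneq (modified_hook lam p) [::].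
  rewrite (bigD1_seq p) ?diagram_uniq //= big1 => [|q /negPf qp].
    by rewrite move_prob_stop ?p_stop // eqxx mul1r addr0.
  by rewrite move_prob_stop ?p_stop // qp mul0r.
pose H := \sum_(q <- modified_hook lam p) move_weight x y p q.
transitivity ((\sum_(q <- modified_hook lam p)
    move_weight x y p q * corner_hitting q) / H).
  have HE : H = \sum_((block_of lam p.1).+1 <= k <
        (c.+1 - block_of (conj_part lam) p.2).+1) X k +
      \sum_((block_of (conj_part lam) p.2).+1 <= k <
        (c.+1 - block_of lam p.1).+1) Y k.
    transitivity (\sum_(q <- modified_hook lam p) move_weight x y p q * (1 * 1)).
      by apply: eq_bigr => q _; rewrite !mulr1.
    rewrite (sum_modified_hook (fun=> 1) (fun=> 1)) //.
    by congr (_ + _); apply: eq_bigr => k _; rewrite !mulr1.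
  have H_neq0 : H != 0.
    move: p_go; rewrite (modified_hook_nil lamP) // HE => ab.
    have abc := block_sum_le lamP pD.
    apply: lt0r_neq0; apply: ltr_pwDl.
      apply: sum_gt0_block X_gt0 _; apply: strict_arm_range => //.
      by rewrite ltn_neqAle ab.
    by apply: sum_ge0_block Y_gt0 _; rewrite subSS leq_subr.
  rewrite sum_modified_hook // hook_factor_harmonic // -/F -/G -HE.
  by rewrite mulfK.
rewrite mulr_suml.
(* The sum over the hook becomes a sum over the diagram, the squares outside the hook having
   transition probability 0. *)
have hD : perm_eq (modified_hook lam p)
                  [seq q <- diagram lam | q \in modified_hook lam p].
  apply: uniq_perm; rewrite ?filter_uniq ?diagram_uniq ?modified_hook_uniq // => q.
  rewrite mem_filter; case: (boolP (q \in _)) => //= qh.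
  by have [->] := mem_modified_hook lamP pD qh.
rewrite (perm_big _ hD) big_filter big_mkcond; apply: eq_bigr => q _.
rewrite /move_prob; case E: (modified_hook lam p) p_go => [//|u h] _.
by rewrite -E; case: ifP => _; rewrite ?mul0r // mulrAC.
Qed.

(** On the boundary, [a < r] forces [b > s] and so a vanishing [G], while [a > r] makes [F] vanish;
    only [a = r], [b = s] remains, with value 1. *)
Lemma corner_hitting_stop p : p \in diagram lam -> modified_hook lam p == [::] ->
  corner_hitting p = (at_corner lam r p)%:R.
Proof.
move=> pD; have [p1 p2] := mem_diagram_conj lamP pD.
rewrite (modified_hook_nil lamP) // /at_corner size_corners //.
rewrite (mem_row_block lamP) // [col_block _ _]/(row_block _ _).
rewrite (mem_row_block conjP) ?size_undup_conj ?size_conj //; last first.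
  by case/andP: r_bounds => r0 rc; apply: strict_arm_range.
rewrite /corner_hitting.
set a := block_of lam p.1; set b := block_of _ p.2 => /eqP abc.
have bE : b = (c.+1 - a)%N by rewrite -abc addKn.
have [ar|ar|ar] := ltngtP a r.
- rewrite andFb /G hook_factor_gt ?mulr0 // bE; apply: ltn_sub2l => //.
  by apply: ltn_trans ar _; case/andP: r_bounds.
- by rewrite andFb /F hook_factor_gt ?mul0r.
by rewrite bE ar eqxx /F /G !hook_factor_id mulr1.
Qed.


Lemma sum_corner_hitting :
  \sum_(p <- diagram lam) x p.1 * y p.2 * corner_hitting p =
  X r * Y s * (\prod_(1 <= i < r) (1 + X i / arm c X Y r i)) *
  (\prod_(1 <= j < s) (1 + Y j / arm c Y X s j)).
Proof.
have [r0 rc] := andP r_bounds.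
have [s0 sc] : (0 < s)%N /\ (s <= c)%N.
  by apply/andP; apply: strict_arm_range.
have sum_F : \sum_(1 <= k < r.+1) X k * F k =
    X r * \prod_(1 <= i < r) (1 + X i / arm c X Y r i).
  exact: sum_hook_factor.
(* A row of block [a <= r] contains the column blocks up to [c + 1 - a], hence all those up to [s],
   past which [G] vanishes. Its column sum is therefore the same for all these rows; rows with
   [a > r] contribute 0 through [F]. *)
have sum_G m : (s <= m)%N -> \sum_(1 <= k < m.+1) Y k * G k =
    Y s * \prod_(1 <= i < s) (1 + Y i / arm c Y X s i).
  move=> sm; rewrite -(sum_hook_factor Y (arm c Y X s) s0).
  rewrite (big_cat_nat (n := s.+1)) //= [X in _ + X]big_nat.
  rewrite [X in _ + X]big1 ?addr0 //.
  by move=> k /andP[sk _]; rewrite /G hook_factor_gt ?mulr0.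
set SG := Y s * _ in sum_G.
transitivity ((\sum_(1 <= k < r.+1) X k * F k) * SG); last first.
  by rewrite sum_F /SG; ring.
transitivity (\sum_(1 <= i < (size lam).+1) x i * F (block_of lam i) * SG).
  rewrite /diagram big_allpairs_dep /index_iota subSS subn0.
  apply: eq_big_seq => i; rewrite mem_iota add1n ltnS => il /=.
  have [ir|ri] := leqP (block_of lam i) r; last first.
    rewrite /corner_hitting /= /F hook_factor_gt // mulr0 mul0r big1 // => j _.
    by rewrite mul0r mulr0.
  rewrite -(sum_G (c.+1 - block_of lam i)%N); last exact: leq_sub2l.
  rewrite -(sum_cols _ (a := 0)); last by rewrite /block_of subSS leq_subr.
  rewrite -part_block // mulr_sumr /index_iota subSS subn0.
  by apply: eq_bigr => j _; rewrite /corner_hitting /=; ring.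
rewrite -mulr_suml; congr (_ * _).
transitivity (\sum_(1 <= k < c.+1) X k * F k).
  by rewrite -(sum_rows _ (a := 0)) ?leqnn // block_end_size.
rewrite (big_cat_nat (n := r.+1)) //= [X in _ + X]big_nat.
rewrite [X in _ + X]big1 ?addr0 //.
by move=> k /andP[rk _]; rewrite /F hook_factor_gt ?mulr0.
Qed.

End Weighted.

(** * Events of random variables with countably many values *)

Lemma measurable_nat_pairs (B : set (nat * nat)) : measurable B.
Proof.
have -> : B = (\bigcup_p (if p \in B then [set p] else set0))%classic.
  apply/seteqP; split=> [p Bp | p [q _]].
    by exists p => //; rewrite mem_set.
  by case: ifP => // /set_mem Bq ->.
apply: countable_bigcupT_measurable => //.
case=> a b; case: ifP => // _.
have -> : ([set (a, b)] = [set a] `*` [set b])%classic.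
  by apply/seteqP; split=> [[u v] [-> ->] // | [u v] /= [-> ->]].
exact: measurableX.
Qed.

Section CountableValues.
Context {R : realType} {d : measure_display} {T : measurableType d}.
Variable P : probability T R.
Implicit Types (X : {RV P >-> (nat * nat)%type}) (A : set T).

Lemma measurable_RV_event X (Q : nat * nat -> Prop) :
  measurable [set t | Q (X t)]%classic.
Proof.
exact: (measurable_funPTI X (measurable_nat_pairs [set p | Q p]%classic)).
Qed.

Lemma probability_sub0 A B : measurable A -> measurable B ->
  (A `<=` B)%classic -> P B = 0%E -> P A = 0%E.
Proof. exact: subset_measure0. Qed.

(** The encoding [pickle] turns the partition of [A] by the values of [X] into a sequence, to which
    countable additivity applies. *)
Lemma measure_fibers X A : measurable A ->
  P A = (\sum_(0 <= v <oo) P (A `&` [set t | pickle (X t) = v])%classic)%E.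
Proof.
move=> mA; rewrite -measure_semi_bigcup.
- congr (P _); apply/seteqP; split=> [t At | t [v _ []]//].
  by exists (pickle (X t)).
- move=> v; apply: measurableI => //.
  exact: (measurable_RV_event X (fun p => pickle p = v)).
- by move=> u v _ _ [t [[_ <-] [_ <-]]].
- apply: bigcupT_measurable => v; apply: measurableI => //.
  exact: (measurable_RV_event X (fun p => pickle p = v)).
Qed.

Lemma fiber_cases X v :
  (exists q, forall A, A `&` [set t | pickle (X t) = v] =
                       A `&` [set t | X t = q])%classic \/
  (forall A, A `&` [set t | pickle (X t) = v] = set0)%classic.
Proof.
have [[q qv]|nq] := pselect (exists q : nat * nat, pickle q = v).
  left; exists q => A; apply/seteqP; split=> t [At].
    by rewrite /= -qv => /(pcan_inj pickleK).
  by move=> /= ->; rewrite -qv.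
right=> A; apply/seteqP; split=> t // [_ /= Xv].
by apply: nq; exists (X t).
Qed.

(** Proportionality with a common ratio may be checked on each fiber of [X]; this is what allows a
    past value of the walk to be summed out. *)
Lemma measure_proportional X A B (r : R) : measurable A -> measurable B ->
  (forall q, P (A `&` [set t | X t = q])%classic =
             (P (B `&` [set t | X t = q])%classic * r%:E)%E) ->
  P A = (P B * r%:E)%E.
Proof.
move=> mA mB AB; rewrite (measure_fibers X mA) (measure_fibers X mB).
rewrite [RHS]muleC -nneseriesZl => [|//]; apply: eq_eseriesr => v _.
case: (fiber_cases X v) => [[q E]|E]; rewrite !E; first by rewrite AB muleC.
by rewrite measure0 mule0.
Qed.

Lemma measure_fibers0 X A : measurable A ->
  (forall q, P (A `&` [set t | X t = q])%classic = 0%E) -> P A = 0%E.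
Proof.
move=> mA A0; rewrite (measure_proportional (X := X) mA mA (r := 0)) ?mule0 // => q.
by rewrite A0 mul0e.
Qed.

(** Induction on [D] removes one fiber at a time, the induction hypothesis being applied to the part
    of [A] where [X] differs from the removed value. *)
Lemma measure_fibers_seq X A (D : seq (nat * nat)) : measurable A -> uniq D ->
  (forall q, q \notin D -> P (A `&` [set t | X t = q])%classic = 0%E) ->
  P A = (\sum_(q <- D) P (A `&` [set t | X t = q])%classic)%E.
Proof.
elim: D A => [|q D IH] A mA /= => [_ A0 | /andP[qD uD] A0].
  by rewrite big_nil; apply: (measure_fibers0 (X := X)) => // q; apply: A0.
have mX Q : measurable (A `&` [set t | Q (X t)])%classic.
  by apply: measurableI => //; apply: measurable_RV_event.
rewrite big_cons.
have -> : P A = (P (A `&` [set t | X t = q])%classic +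
                 P (A `&` [set t | X t <> q])%classic)%E.
  rewrite -measureU.
  - congr (P _); apply/seteqP; split=> [t At | t [[]|[]]//].
    by have [e|e] := pselect (X t = q); [left | right].
  - exact: (mX (fun p => p = q)).
  - exact: (mX (fun p => p <> q)).
  - by apply/seteqP; split=> t // [[_ ?] [_ ?]].
congr (_ + _)%E; rewrite IH //; last first.
- move=> p pD; have [->|pq] := eqVneq p q.
    rewrite [X in P X](_ : _ = set0) ?measure0 //.
    by apply/seteqP; split=> t // [[_ ?] ?].
  apply: (probability_sub0 (B := (A `&` [set t | X t = p])%classic)).
  + by apply: measurableI; [exact: (mX (fun p => p <> q))
                           | exact: (measurable_RV_event X (fun u => u = p))].
  + exact: (mX (fun u => u = p)).
  + by move=> t [[]].
  + by apply: A0; rewrite inE negb_or pq.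
- exact: (mX (fun p => p <> q)).
apply: eq_big_seq => p pD; congr (P _); apply/seteqP; split=> t [].
  by case.
move=> At /= Xp; split=> //; split=> // Xq.
by move: qD; rewrite -Xq Xp pD.
Qed.

End CountableValues.

(** * Absorption in a finite Markov chain graded by a rank *)

Section MarkovChain.
Context {R : realType} {d : measure_display} {T : measurableType d}.
Variable P : probability T R.
Variables (nu : nat * nat -> R) (K : nat * nat -> nat * nat -> R).
Variable W : nat -> {RV P >-> (nat * nat)%type}.
Hypothesis W_init : forall p, P [set t | W 0%N t = p]%classic = (nu p)%:E.
Hypothesis W_step : forall n (h : nat -> nat * nat),
  P [set t | forall k, (k <= n.+1)%N -> W k t = h k]%classic =
  (P [set t | forall k, (k <= n)%N -> W k t = h k]%classic *
   (K (h n) (h n.+1))%:E)%E.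

Lemma measurable_history m n (h : nat -> nat * nat) :
  measurable [set t | forall k, (m <= k <= n)%N -> W k t = h k]%classic.
Proof.
have -> : [set t | forall k, (m <= k <= n)%N -> W k t = h k]%classic =
    (\bigcap_k [set t | (m <= k <= n)%N -> W k t = h k])%classic.
  by apply/seteqP; split=> t /= H k; [move=> _; exact: H | exact: H].
apply: bigcapT_measurable => k.
exact: (measurable_RV_event (W k) (fun p => (m <= k <= n)%N -> p = h k)).
Qed.

(* The history is forgotten one time at a time, by summing over the values of its
   earliest square. *)
Lemma W_step_from m n (h : nat -> nat * nat) : (m <= n)%N ->
  P [set t | forall k, (m <= k <= n.+1)%N -> W k t = h k]%classic =
  (P [set t | forall k, (m <= k <= n)%N -> W k t = h k]%classic *
   (K (h n) (h n.+1))%:E)%E.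
Proof.
elim: m h => [|m IH] h mn; first exact: W_step.
apply: (measure_proportional (X := W m)); try exact: measurable_history.
(* Fixing [W m] to be [q] turns a history starting after [m] into the history of [h'] starting at
   [m], to which the induction hypothesis applies. *)
move=> q; pose h' k := if k == m then q else h k.
have split_m N : (m <= N)%N ->
    ([set t | forall k, (m < k <= N)%N -> W k t = h k] `&`
       [set t | W m t = q] =
     [set t | forall k, (m <= k <= N)%N -> W k t = h' k])%classic.
  move=> mN; apply/seteqP; split=> t /=.
    move=> [Wh Wq] k /andP[mk kN]; rewrite /h'; case: eqVneq => [->//|km].
    by apply: Wh; rewrite ltn_neqAle eq_sym km mk.
  move=> Wh'; split=> [k /andP[mk kN]|].
    by rewrite Wh' ?(ltnW mk) // /h' gtn_eqF.
  by rewrite Wh' ?leqnn // /h' eqxx.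
rewrite !split_m ?(ltnW mn) ?(leq_trans (ltnW mn)) // IH ?(ltnW mn) //.
by rewrite /h' !gtn_eqF // ltnS ltnW.
Qed.

Lemma W_transition n p q :
  P ([set t | W n t = p] `&` [set t | W n.+1 t = q])%classic =
  (P [set t | W n t = p]%classic * (K p q)%:E)%E.
Proof.
have := @W_step_from n n (fun k => if k == n then p else q) (leqnn n).
rewrite eqxx gtn_eqF //.
have -> : [set t | forall k, (n <= k <= n)%N ->
    W k t = if k == n then p else q]%classic = [set t | W n t = p]%classic.
  apply/seteqP; split=> t /= => [/(_ n)|Wp k].
    by rewrite eqxx leqnn; apply.
  by rewrite -eqn_leq => /eqP <-; rewrite eqxx.
move=> <-; congr (P _); apply/seteqP; split=> t /=.
  move=> [Wp Wq] k; case: eqVneq => [->//|kn /andP[nk kn1]].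
  suff -> : k = n.+1 by [].
  by apply/eqP; rewrite eqn_leq kn1 ltn_neqAle eq_sym kn.
move=> H; split; first by have := H n; rewrite eqxx leqnn leqnSn; apply.
by have := H n.+1; rewrite gtn_eqF // leqnn leqnSn; apply.
Qed.

Let mu n p : R := fine (P [set t | W n t = p]%classic).

Let muE n p : P [set t | W n t = p]%classic = (mu n p)%:E.
Proof.
rewrite /mu fineK // fin_num_measure //.
exact: (measurable_RV_event (W n) (fun u => u = p)).
Qed.

Variables (D : seq (nat * nat)) (stop : pred (nat * nat)).
Variables (rank : nat * nat -> nat) (M : nat).
Hypothesis D_uniq : uniq D.
Hypothesis nu_out : forall p, p \notin D -> nu p = 0.
Hypothesis K_out : forall p q, p \in D -> q \notin D -> K p q = 0.
Hypothesis K_stop : forall p q, stop p -> K p q = (q == p)%:R.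
Hypothesis K_rank : forall p q, p \in D -> ~~ stop p ->
  (rank q <= rank p)%N -> K p q = 0.
Hypothesis rank_lt : forall p, p \in D -> (rank p < M)%N.

Lemma law_out n p : p \notin D -> mu n p = 0.
Proof.
elim: n p => [|n IH] p pD.
  by apply: EFin_inj; rewrite -muE W_init nu_out.
apply: EFin_inj; rewrite -muE.
apply: (measure_fibers0 (X := W n)).
  exact: (measurable_RV_event (W n.+1) (fun u => u = p)).
move=> q; rewrite setIC W_transition muE.
by have [qD|qD] := boolP (q \in D); [rewrite K_out ?mule0 | rewrite IH ?mul0e].
Qed.

Lemma law_step n q : mu n.+1 q = \sum_(p <- D) mu n p * K p q.
Proof.
apply: EFin_inj; rewrite -muE -sumEFin (measure_fibers_seq (X := W n) (D := D)) //.
- by apply: eq_bigr => p _; rewrite setIC W_transition muE EFinM.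
- exact: (measurable_RV_event (W n.+1) (fun u => u = q)).
by move=> p pD; rewrite setIC W_transition muE law_out ?mul0e.
Qed.

(** Every move out of an unstopped state raises the rank and stopped states are never left, so an
    unstopped state at time [n] has made [n] rank-raising moves. *)
Lemma law_rank n p : ~~ stop p -> (rank p < n)%N -> mu n p = 0.
Proof.
elim: n p => // n IH p p_go pn; rewrite law_step big1_seq // => q /andP[_ qD].
have [q_stop|q_go] := boolP (stop q).
  rewrite K_stop //; case: eqVneq => [pq|_]; last by rewrite mulr0.
  by rewrite pq q_stop in p_go.
have [pq|qp] := leqP (rank p) (rank q); first by rewrite K_rank ?mulr0.
by rewrite IH ?mul0r // (leq_trans qp).
Qed.

(** The martingale property: one step of the chain does not change the mean of a harmonic
    function. *)
Lemma law_harmonic (f : nat * nat -> R) n :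
  (forall p, p \in D -> f p = \sum_(q <- D) K p q * f q) ->
  \sum_(p <- D) mu n p * f p = \sum_(p <- D) nu p * f p.
Proof.
move=> f_harm; elim: n => [|n IH].
  by apply: eq_bigr => p _; congr (_ * _); apply: EFin_inj; rewrite -muE W_init.
under eq_bigr do rewrite law_step mulr_suml.
rewrite exchange_big -IH; apply: eq_big_seq => p pD.
by rewrite f_harm // mulr_sumr; apply: eq_bigr => q _; rewrite mulrA.
Qed.

Lemma law_not_stopped : P [set t | ~~ stop (W M t)]%classic = 0%E.
Proof.
apply: (measure_fibers0 (X := W M)) => [|q].
  exact: (measurable_RV_event (W M) (fun u => ~~ stop u)).
have [q_stop|q_go] := boolP (stop q).
  rewrite [X in P X](_ : _ = set0) ?measure0 //.
  by apply/seteqP; split=> t // [/= + Wq]; rewrite Wq q_stop.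
apply: (probability_sub0 (B := [set t | W M t = q]%classic)).
- apply: measurableI; first exact: (measurable_RV_event (W M) (fun u => ~~ stop u)).
  exact: (measurable_RV_event (W M) (fun u => u = q)).
- exact: (measurable_RV_event (W M) (fun u => u = q)).
- by move=> t [].
rewrite muE; have [qD|qD] := boolP (q \in D); last by rewrite law_out.
by rewrite law_rank // rank_lt.
Qed.

Lemma measurable_transition n (Q : nat * nat -> nat * nat -> Prop) :
  measurable [set t | Q (W n t) (W n.+1 t)]%classic.
Proof.
have -> : [set t | Q (W n t) (W n.+1 t)]%classic =
    (\bigcup_p ([set t | W n t = p] `&` [set t | Q p (W n.+1 t)]))%classic.
  apply/seteqP; split=> [t Qt | t [p _ [/= <-]]//].
  by exists (W n t).
apply: countable_bigcupT_measurable => [|p]; first exact: countableP.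
apply: measurableI.
  exact: (measurable_RV_event (W n) (fun u => u = p)).
exact: (measurable_RV_event (W n.+1) (Q p)).
Qed.

Lemma law_leave_stop n :
  P [set t | stop (W n t) /\ W n.+1 t <> W n t]%classic = 0%E.
Proof.
have mL := measurable_transition n (fun p q => stop p /\ q <> p).
apply: (measure_fibers0 (X := W n)) => // p.
have mLp : measurable ([set t | stop (W n t) /\ W n.+1 t <> W n t] `&`
                       [set t | W n t = p])%classic.
  by apply: measurableI => //; exact: (measurable_RV_event (W n) (fun u => u = p)).
apply: (measure_fibers0 (X := W n.+1)) => // q.
set A := (X in P X).
have [E|/not_andP NE] := pselect (stop p /\ q <> p); last first.
  rewrite [A](_ : _ = set0) ?measure0 //; apply/seteqP; split=> t //.
  move=> [[/= [st ne] Wp] Wq]; rewrite Wp Wq in ne st.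
  by case: NE.
apply: (probability_sub0
  (B := ([set t | W n t = p] `&` [set t | W n.+1 t = q])%classic)).
- by apply: measurableI => //; exact: (measurable_RV_event (W n.+1) (fun u => u = q)).
- apply: measurableI; first exact: (measurable_RV_event (W n) (fun u => u = p)).
  exact: (measurable_RV_event (W n.+1) (fun u => u = q)).
- by move=> t [[_ ?] ?].
rewrite W_transition K_stop; last by case: E.
by case: E => _ /eqP/negPf ->; rewrite mule0.
Qed.

(** At time [M] the chain has almost surely stopped, and there [f] is the indicator of [Q]. The mean
    of [f] at time [M] is thus the absorption probability, and by harmonicity it equals the mean at
    time 0. *)
Lemma absorption_probability (Q : nat * nat -> Prop) (f : nat * nat -> R) :
  (forall p, p \in D -> f p = \sum_(q <- D) K p q * f q) ->
  (forall p, p \in D -> stop p -> f p = `[< Q p >]%:R) ->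
  P [set t | exists n, stop (W n t) /\ Q (W n t)]%classic =
  (\sum_(p <- D) nu p * f p)%:E.
Proof.
move=> f_harm f_stop.
pose S p := stop p /\ Q p.
pose E := [set t | exists n, S (W n t)]%classic.
pose L := (\bigcup_n [set t | stop (W n t) /\ W n.+1 t <> W n t])%classic.
pose N := [set t | ~~ stop (W M t)]%classic.
pose EM := [set t | S (W M t)]%classic.
have mEM : measurable EM by exact: (measurable_RV_event (W M) S).
have mN : measurable N.
  exact: (measurable_RV_event (W M) (fun u => ~~ stop u)).
have mLn n : measurable [set t | stop (W n t) /\ W n.+1 t <> W n t]%classic.
  exact: (measurable_transition n (fun p q => stop p /\ q <> p)).
have mL : measurable L by exact: bigcupT_measurable.
have mE : measurable E.
  rewrite [E](_ : _ = \bigcup_n [set t | S (W n t)])%classic; last first.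
    by apply/seteqP; split=> [t [n Sn]|t [n _ Sn]]; exists n.
  by apply: bigcupT_measurable => n; exact: (measurable_RV_event (W n) S).
have L0 : P L = 0%E.
  apply: measure_negligible => //; apply: negligible_bigcup => n.
  by apply/negligibleP => //; exact: law_leave_stop.
(* Outside the null set L `|` N, a path never leaves a stopped state and is
   stopped at time M, so that E amounts to EM. *)
have LN0 : P (L `|` N)%classic = 0%E.
  by rewrite measureU0 //; exact: law_not_stopped.
have stay t m n : ~ L t -> stop (W m t) -> (m <= n)%N -> W n t = W m t.
  move=> nL st /subnK <-; elim: (n - m)%N => [//|k IH].
  rewrite addSn -IH; apply: contrapT => ne; apply: nL; exists (k + m)%N => //.
  by split=> //; rewrite IH.
have E_EM t : ~ (L `|` N)%classic t -> E t -> EM t.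
  move=> /not_orP[nL /negP]; rewrite negbK => stM [n Sn].
  case: (leqP n M) => nM; rewrite /EM /=.
    by rewrite (stay _ _ _ nL _ nM) //; case: Sn.
  by rewrite -(stay _ _ _ nL stM (ltnW nM)).
transitivity (P EM).
  transitivity (P (E `|` (L `|` N))%classic).
    by rewrite measureU0 //; exact: measurableU.
  transitivity (P (EM `|` (L `|` N))%classic).
    congr (P _); apply/seteqP; split=> t []; try by right.
      by have [B|B] := pselect ((L `|` N)%classic t); [right | left; exact: E_EM].
    by left; exists M.
  by rewrite measureU0 //; exact: measurableU.
(* Compare the two sides state by state at time [M]: stopped states carry the indicator of [Q],
   unstopped ones have mass 0. *)
rewrite -(law_harmonic M f_harm) (measure_fibers_seq (X := W M) mEM D_uniq).
  rewrite -sumEFin; apply: eq_big_seq => p pD.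
  have [Sp|nSp] := pselect (S p).
    rewrite f_stop; [|by []|by case: Sp]; rewrite asboolT; last by case: Sp.
    rewrite mulr1 -muE; congr (P _); apply/seteqP; split=> t; first by case.
    by move=> /= Wp; rewrite /EM /= Wp.
  rewrite [X in P X](_ : _ = set0); last first.
    by apply/seteqP; split=> t // [/= + Wp]; rewrite /EM /= Wp.
  rewrite measure0; have [p_stop|p_go] := boolP (stop p).
    by rewrite f_stop // asboolF ?mulr0 // => Qp; apply: nSp.
  by rewrite law_rank ?mul0r // rank_lt.
move=> q qD; apply: (probability_sub0 (B := [set t | W M t = q]%classic)).
- by apply: measurableI => //; exact: (measurable_RV_event (W M) (fun u => u = q)).
- exact: (measurable_RV_event (W M) (fun u => u = q)).
- by move=> t [].
by rewrite muE law_out.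
Qed.

End MarkovChain.

Theorem theorem4p2 (R : realType) (lam : seq nat) (c : nat) (x y : nat -> R)
    (lam_part : is_partition lam)
    (lam_corners : size (corners lam) = c)
    (x_gt0 : forall i, (1 <= i <= part (conj_part lam) 1)%N -> 0 < x i)
    (y_gt0 : forall j, (1 <= j <= part lam 1)%N -> 0 < y j)
    (d : measure_display) (T : measurableType d) (P : probability T R)
    (W : nat -> {RV P >-> (nat * nat)%type})
    (W_walk : is_modified_hook_walk lam x y W)
    (r s : nat) (r_bounds : (1 <= r <= c)%N) (sE : s = (c.+1 - r)%N) :
  let X := row_weight lam x in
  let Y := col_weight lam y in
  P (ends_in_corner lam W r) =
  (X r * Y s / (\sum_(p <- diagram lam) x p.1 * y p.2) *
   (\prod_(1 <= i < r)
      (1 + X i / (\sum_(i.+1 <= k < r.+1) X k +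
                  \sum_(s.+1 <= k < (c.+1 - i).+1) Y k))) *
   (\prod_(1 <= j < s)
      (1 + Y j / (\sum_(r.+1 <= k < (c.+1 - j).+1) X k +
                  \sum_(j.+1 <= k < s.+1) Y k))))%:E.
Proof.
move=> X Y; have [W_init W_step] := W_walk.
rewrite size_corners // in lam_corners; subst c s.
have x_pos i : (1 <= i <= size lam)%N -> 0 < x i by rewrite -conj1 //; exact: x_gt0.
pose stop p := modified_hook lam p == [::].
have -> : ends_in_corner lam W r =
    [set t | exists n, stop (W n t) /\ at_corner lam r (W n t)]%classic.
  by apply/seteqP; split=> t [n [/eqP st at_r]]; exists n; split=> //; apply/eqP.
have out_start p : p \notin diagram lam -> start_prob lam x y p = 0.
  by move=> /negPf pD; rewrite /start_prob pD.
(* The grading is [p.1 + p.2], so the number of rows plus the number of columns plus one bounds the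
   time of absorption. *)
have rank_lt p : p \in diagram lam -> (p.1 + p.2 < (size lam + part lam 1).+1)%N.
  by move=> /(mem_diagram_conj lam_part)[/andP[_ p1] /andP[_ p2]];
    rewrite ltnS leq_add.
rewrite (absorption_probability (stop := stop) (Q := fun p => at_corner lam r p)
  W_init W_step (diagram_uniq lam) out_start
  (move_prob_out lam_part x y) (move_prob_stop (lam := lam) x y)
  (move_prob_back lam_part x y) rank_lt
  (corner_hitting_harmonic lam_part x_pos y_gt0 r_bounds)); last first.
  by move=> p pD p_stop; rewrite asboolb; exact: corner_hitting_stop.
congr EFin.
transitivity ((\sum_(p <- diagram lam) x p.1 * y p.2 *
  corner_hitting lam x y r p) / diagram_weight lam x y).
  rewrite mulr_suml; apply: eq_big_seq => p pD.
  by rewrite /start_prob pD mulrAC.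
rewrite sum_corner_hitting // -/X -/Y /diagram_weight.
rewrite mulrAC; congr (_ * _); first by rewrite mulrAC.
(* In the column product [arm] has the roles of [X] and [Y] exchanged: [c + 1 - s] is [r] again, and
   the two sums must be swapped. *)
apply: eq_bigr => j _; rewrite /arm subKn; last by apply: leqW; case/andP: r_bounds.
by rewrite [X in _ = 1 + _ / X]addrC.
Qed.
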